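(* Let $f:\mathcal{D}(\mathcal{H})\to\mathbb{R}$ be a concave, continuous function which is Gâteaux-differentiable on $\mathcal{D}_+(\mathcal{H})$. Let $\sigma\in\mathcal{D}(\mathcal{H})$ and $\varepsilon\in(0,1]$. Then for any $\rho\in B^+_\varepsilon(\sigma)$, $$\mathrm{Tr}\big(\nabla f(\rho)(\rho-\sigma)\big)\le\varepsilon\big(\lambda_+(\nabla f(\rho))-\lambda_-(\nabla f(\rho))\big).\qquad( * )$$ Furthermore, for $\rho\in B^+_\varepsilon(\sigma)$ the following are equivalent: 1. Equality holds in $( * )$. 2. $\rho\in\operatorname{argmax}_{B_\varepsilon(\sigma)}f$. 3. Both of the following hold: (a) either $\frac12\|\rho-\sigma\|_1=\varepsilon$ or $\nabla f(\rho)=\lambda\mathbf{1}$ for some $\lambda\in\mathbb{R}$; and (b) $\pi_\pm\nabla f(\rho)\pi_\pm=\lambda_\pm(\nabla f(\rho))\,\pi_\pm$ (for both signs), where $\pi_\pm$ is the projection onto the support of $\Delta_\pm$ and $\Delta=\Delta_+-\Delta_-$ is the Jordan decomposition of $\Delta:=\rho-\sigma$.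
   Context: $\mathcal{H}$ is a finite-dimensional complex Hilbert space; $\mathcal{B}_{\mathrm{sa}}(\mathcal{H})$ is the real Hilbert space of self-adjoint operators on $\mathcal{H}$ with Hilbert–Schmidt inner product $\langle A,B\rangle=\mathrm{Tr}(AB)$; $\mathcal{D}(\mathcal{H})$ is the set of states (positive semidefinite, trace one) and $\mathcal{D}_+(\mathcal{H})$ the set of positive definite states. $\|A\|_1=\mathrm{Tr}|A|$, $B_\varepsilon(\sigma)=\{\omega\in\mathcal{D}(\mathcal{H}):\frac12\|\omega-\sigma\|_1\le\varepsilon\}$ and $B^+_\varepsilon(\sigma)=B_\varepsilon(\sigma)\cap\mathcal{D}_+(\mathcal{H})$. $\lambda_+(A)$ and $\lambda_-(A)$ denote the largest and smallest eigenvalues of a self-adjoint $A$. The Jordan decomposition $\Delta=\Delta_+-\Delta_-$ is the decomposition into positive and negative parts ($\Delta_\pm\ge0$, $\Delta_+\Delta_-=0$). Gâteaux-differentiability: let $\mathcal{X}=\mathcal{B}_{\mathrm{sa}}(\mathcal{H})$. The directional derivative of a function $f$ at $x$ in the direction $h\in\mathcal{X}$ is $f'(x;h)=\lim_{t\downarrow0}\frac1t[f(x+th)-f(x)]$. The function $f$ is Gâteaux-differentiable at $x$ if the map $\mathcal{X}\ni h\mapsto f'(x;h)$ is linear and continuous, and Gâteaux-differentiable on a set if it is so at each of its points. In that case the Gâteaux gradient $\nabla f(x)\in\mathcal{X}$ is the unique element with $\mathrm{Tr}(\nabla f(x)h)=f'(x;h)$ for every $h\in\mathcal{X}$. (Here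 $f$ is understood as extended to a function on $\mathcal{X}$, so that $f'(x;h)$ makes sense for all $h\in\mathcal{X}$.) *)

(* Defs.v *)
From HB Require Import structures.
From mathcomp Require Import all_boot all_order all_algebra.
From mathcomp Require Import all_classical all_reals all_analysis.
From mathcomp Require Import complex sesquilinear spectral.

Set Implicit Arguments.
Unset Strict Implicit.
Unset Printing Implicit Defensive.

Import Order.TTheory GRing.Theory Num.Theory.
Import numFieldNormedType.Exports.

Local Open Scope classical_set_scope.
Local Open Scope ring_scope.
Local Open Scope complex_scope.
Local Open Scope sesquilinear_scope.

(* The Hilbert space is C^n with C = R[i], and operators on it are n x n      *)
(* matrices. The case n = 0 is harmless: there are no states.                 *)

(* MathComp-Analysis puts the norm topology on R[i]^o only; with this copy,   *)
(* 'M[R[i]]_n carries its usual (entrywise) topology.                         *)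
HB.instance Definition _ (R : realType) := NormedModule.copy R[i] R[i]^o.

Section Operators.
Context {R : realType} {n : nat}.
Implicit Types A D P : 'M[R[i]]_n.

Definition selfadjoint : set 'M[R[i]]_n := [set A | A \is hermsymmx].

(* In R[i], 0 <= z (resp. 0 < z) means that z is real and nonnegative (resp.  *)
(* positive).                                                                 *)
Definition psd : set 'M[R[i]]_n :=
  [set A | selfadjoint A /\
           forall v : 'cV[R[i]]_n, 0 <= (v^t* *m A *m v) 0 0].

Definition posdef : set 'M[R[i]]_n :=
  [set A | selfadjoint A /\
           forall v : 'cV[R[i]]_n, v != 0 -> 0 < (v^t* *m A *m v) 0 0].

Definition states : set 'M[R[i]]_n := [set A | psd A /\ \tr A = 1].

Definition posdef_states : set 'M[R[i]]_n := states `&` posdef.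

(* The positive semidefinite square root exists and is unique for every       *)
(* positive semidefinite P (0 is a junk value otherwise).                     *)
Definition psd_sqrt P : 'M[R[i]]_n :=
  xget 0 [set S | psd S /\ S *m S = P].

Definition absmx A : 'M[R[i]]_n := psd_sqrt (A^t* *m A).

Definition trace_norm A : R := complex.Re (\tr (absmx A)).

Definition trace_ball (eps : R) (sigma : 'M[R[i]]_n) : set 'M[R[i]]_n :=
  [set omega | states omega /\ 2^-1 * trace_norm (omega - sigma) <= eps].

Definition posdef_trace_ball (eps : R) (sigma : 'M[R[i]]_n) :
    set 'M[R[i]]_n :=
  trace_ball eps sigma `&` posdef_states.

(* For n > 0 and A self-adjoint these sets are finite and nonempty, so that   *)
(* sup and inf are the maximum and the minimum.                               *)
Definition max_eigenvalue A : R := sup [set x : R | eigenvalue A x%:C].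

Definition min_eigenvalue A : R := inf [set x : R | eigenvalue A x%:C].

(* The pair (D_+, D_-), which exists and is unique for D self-adjoint.        *)
Definition jordan_parts D : 'M[R[i]]_n * 'M[R[i]]_n :=
  xget (0, 0) [set B | [/\ psd B.1, psd B.2, B.1 *m B.2 = 0
                         & D = B.1 - B.2]].

Definition pos_part_mx D : 'M[R[i]]_n := (jordan_parts D).1.

Definition neg_part_mx D : 'M[R[i]]_n := (jordan_parts D).2.

(* proj_ortho A is the Hermitian idempotent whose row space is that of A;     *)
(* acting on column vectors, it projects onto the range of A^t*, i.e. onto    *)
(* the orthogonal complement of the kernel of A.                              *)
Definition support_proj A : 'M[R[i]]_n := proj_ortho A.

End Operators.

Section Functions.
Context {R : realType} {n : nat}.
Implicit Types (f : 'M[R[i]]_n -> R) (x h : 'M[R[i]]_n).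

Definition concave_on (K : set 'M[R[i]]_n) f : Prop :=
  forall x y (t : R), K x -> K y -> 0 <= t <= 1 ->
    t * f x + (1 - t) * f y <= f (t%:C *: x + (1 - t)%:C *: y).

Definition diff_quotient f x h (t : R) : R :=
  t^-1 * (f (x + t%:C *: h) - f x).

Definition dir_derivative f x h : R :=
  lim (diff_quotient f x h t @[t --> (0 : R)^'+]).

Definition gateaux_differentiable f x : Prop :=
  [/\ forall h, selfadjoint h -> cvg (diff_quotient f x h t @[t --> (0 : R)^'+]),
      forall (a b : R) h k, selfadjoint h -> selfadjoint k ->
        dir_derivative f x (a%:C *: h + b%:C *: k) =
        a * dir_derivative f x h + b * dir_derivative f x k
    & {within selfadjoint, continuous (dir_derivative f x)}].

(* Exists and is unique when f is Gateaux-differentiable at x, by the Riesz   *)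
(* representation theorem for the Hilbert-Schmidt inner product.              *)
Definition gradient f x : 'M[R[i]]_n :=
  xget 0 [set G | selfadjoint G /\
    forall h, selfadjoint h -> \tr (G *m h) = (dir_derivative f x h)%:C].

Definition argmax (K : set 'M[R[i]]_n) f : set 'M[R[i]]_n :=
  [set x | K x /\ forall y, K y -> f y <= f x].

End Functions.

(* Main.v *)
(* Write rho - sigma = P - N with P N = 0, so that tr P = tr N = t is half the  *)
(* trace norm. With M and m the extreme eigenvalues of the gradient G,          *)
(*   eps (M - m) - tr (G (rho - sigma))                                         *)
(*     = (eps - t) (M - m) + tr ((M - G) P) + tr ((G - m) N),                   *)
(* and the three terms on the right are nonnegative: this is the inequality,    *)
(* and equality holds iff all three vanish, which is condition 3. If equality   *)
(* holds, the inequality for the other states of the ball says that the         *)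
(* directional derivatives of f at rho towards them are nonpositive, so rho is  *)
(* a maximizer by concavity. Conversely, rho being positive definite, a short   *)
(* segment from rho towards sigma + eps (v v* - w w* ), with v and w unit       *)
(* eigenvectors of G for M and m, stays in the ball; the derivative of f along  *)
(* it is eps (M - m) - tr (G (rho - sigma)), nonpositive at a maximizer.        *)

Require Import Defs.
From mathcomp Require Import all_boot all_order all_algebra.
From mathcomp Require Import all_classical all_reals all_analysis.
From mathcomp Require Import complex sesquilinear spectral.
From mathcomp Require Import ring lra.

Set Implicit Arguments.
Unset Strict Implicit.
Unset Printing Implicit Defensive.

Import Order.TTheory GRing.Theory Num.Theory.
Import numFieldNormedType.Exports.

Local Open Scope classical_set_scope.
Local Open Scope ring_scope.
Local Open Scope complex_scope.
Local Open Scope sesquilinear_scope.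

(** The right-hand side of the bound is the maximum of tr(G D) over traceless self-adjoint D with
    half trace norm at most [eps]. Equality at rho therefore says that rho - sigma maximizes the
    linearization of f over this set. Concavity turns this into maximality of f on the ball. The
    converse needs D for which sigma + D may fail to be a state, and positive definiteness of rho
    makes a short move in that direction feasible.

    The gap identity is [optimality_gap]; [optimality_gap_eq0] reads off the inequality and its
    equality case, and [psd_mxtrace_support] turns vanishing traces into the compressions of
    condition 3. The link with maximality rests on [concave_dir_derivative_ge] in one direction and
    on [trace_ball_segment] with [dir_derivative_le0] in the other. [psd_sqrt_unique],
    [jordan_partsP] and [gradientP] give access to notions defined by choice. *)

Section Gram.
Context {C : numClosedFieldType}.

(** * Adjoints and the Hilbert-Schmidt norm *)

Lemma trmxC_mul m n p (A : 'M[C]_(m, n)) (B : 'M[C]_(n, p)) :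
  (A *m B)^t* = B^t* *m A^t*.
Proof. by rewrite trmx_mul map_mxM. Qed.

Lemma trmxCB m n (A B : 'M[C]_(m, n)) : (A - B)^t* = A^t* - B^t*.
Proof. by apply/matrixP => i j; rewrite !mxE rmorphB. Qed.

Lemma trmxCD m n (A B : 'M[C]_(m, n)) : (A + B)^t* = A^t* + B^t*.
Proof. by apply/matrixP => i j; rewrite !mxE rmorphD. Qed.

Lemma trmxCZ m n c (A : 'M[C]_(m, n)) : (c *: A)^t* = c^*%R *: A^t*.
Proof. by apply/matrixP => i j; rewrite !mxE rmorphM. Qed.

Lemma mxtrace_gram m n (A : 'M[C]_(m, n)) :
  \tr (A *m A^t*) = \sum_i \sum_j `|A i j| ^+ 2.
Proof.
by apply: eq_bigr => i _; rewrite mxE; apply: eq_bigr => j _; rewrite !mxE normCK.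
Qed.

Lemma mxtrace_gram_ge0 m n (A : 'M[C]_(m, n)) : 0 <= \tr (A *m A^t*).
Proof.
by rewrite mxtrace_gram; do 2!apply: sumr_ge0 => ? _; rewrite exprn_ge0.
Qed.

Lemma mxtrace_gram_eq0 m n (A : 'M[C]_(m, n)) : \tr (A *m A^t*) = 0 -> A = 0.
Proof.
rewrite mxtrace_gram => A0; apply/matrixP => i j; rewrite mxE.
have sq_ge0 k l : 0 <= `|A k l| ^+ 2 by rewrite exprn_ge0.
have /psumr_eq0P/(_ A0 i isT) Ai0 : forall k, true -> 0 <= \sum_l `|A k l| ^+ 2.
  by move=> k _; apply: sumr_ge0.
have /psumr_eq0P/(_ Ai0 j isT)/eqP : forall l, true -> 0 <= `|A i l| ^+ 2 by [].
by rewrite sqrf_eq0 normr_eq0 => /eqP.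
Qed.

End Gram.

(** * Positive semidefinite matrices, Jordan parts, support projections, trace norm *)

Section PositiveMatrices.
Context {R : realType} {n : nat}.
Implicit Types (A B D P Q : 'M[R[i]]_n) (d e : 'rV[R]_n).

Lemma selfadjointP A : selfadjoint A <-> A^t* = A.
Proof.
rewrite /selfadjoint/=; split.
  by move=> /is_hermitianmxP; rewrite expr0 scale1r => <-.
by move=> AE; apply/is_hermitianmxP; rewrite expr0 scale1r.
Qed.

Lemma selfadjoint_lin (a b : R) A B :
  selfadjoint A -> selfadjoint B -> selfadjoint (a%:C *: A + b%:C *: B).
Proof.
move=> /selfadjointP hA /selfadjointP hB; apply/selfadjointP.
by rewrite trmxCD !trmxCZ hA hB; congr (_ *: _ + _ *: _); exact: conjc_real.
Qed.

Lemma selfadjointB A B : selfadjoint A -> selfadjoint B -> selfadjoint (A - B).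
Proof.
by move=> /selfadjointP hA /selfadjointP hB; apply/selfadjointP; rewrite trmxCB hA hB.
Qed.

Lemma psd_selfadjoint A : psd A -> selfadjoint A.
Proof. by case. Qed.

Lemma psd_gram m (B : 'M[R[i]]_(m, n)) : psd (B^t* *m B).
Proof.
split; first by apply/selfadjointP; rewrite trmxC_mul trmxCK.
move=> v; have := mxtrace_gram_ge0 (v^t* *m B^t*).
by rewrite trace_mx11 trmxC_mul !trmxCK !mulmxA.
Qed.

Lemma psd_congr A B : psd A -> psd (B^t* *m A *m B).
Proof.
move=> [/selfadjointP hA pA]; split.
  by apply/selfadjointP; rewrite !trmxC_mul trmxCK hA mulmxA.
by move=> v; have := pA (B *m v); rewrite trmxC_mul !mulmxA.
Qed.

Lemma psdD A B : psd A -> psd B -> psd (A + B).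
Proof.
move=> [/selfadjointP hA pA] [/selfadjointP hB pB]; split.
  by apply/selfadjointP; rewrite trmxCD hA hB.
by move=> v; rewrite mulmxDr mulmxDl mxE addr_ge0.
Qed.

Lemma psdZ (a : R) A : 0 <= a -> psd A -> psd (a%:C *: A).
Proof.
move=> a0 [hA pA]; split.
  by have := selfadjoint_lin a 0 hA hA; rewrite scale0r addr0.
by move=> v; rewrite -scalemxAr -scalemxAl mxE mulr_ge0// lecR.
Qed.

Definition cdiag_mx d : 'M[R[i]]_n :=
  diag_mx (map_mx (real_complex R) d).

Lemma cdiag_mx_adj d : (cdiag_mx d)^t* = cdiag_mx d.
Proof.
rewrite tr_diag_mx; apply/matrixP=> i j; rewrite !mxE rmorphMn/=.
by congr (_ *+ _); exact: conjc_real.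
Qed.

Lemma mul_cdiag_mx d e :
  cdiag_mx d *m cdiag_mx e = cdiag_mx (\row_i (d 0 i * e 0 i)).
Proof.
by rewrite mulmx_diag; congr diag_mx; apply/rowP => i; rewrite !mxE rmorphM.
Qed.

Lemma psd_cdiag d : (forall i, 0 <= d 0 i) -> psd (cdiag_mx d).
Proof.
move=> d0; have -> : cdiag_mx d = (cdiag_mx (map_mx Num.sqrt d))^t* *m
    cdiag_mx (map_mx Num.sqrt d).
  rewrite cdiag_mx_adj mul_cdiag_mx; congr cdiag_mx.
  by apply/rowP => i; rewrite !mxE -expr2 sqr_sqrtr.
exact: psd_gram.
Qed.

(** Taking real parts loses nothing, since the spectral diagonal of a self-adjoint matrix is real; a
    diagonal over [R] lets eigenvalues be compared. *)
Lemma selfadjoint_spectral A : selfadjoint A ->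
  exists U d, U \is unitarymx /\ A = U^t* *m cdiag_mx d *m U.
Proof.
move=> hA; exists (spectralmx A), (map_mx (@complex.Re R) (spectral_diag A)).
split; first exact: spectral_unitarymx.
have dE : map_mx (real_complex R) (map_mx (@complex.Re R) (spectral_diag A)) =
    spectral_diag A.
  apply/rowP => i; rewrite !mxE/=.
  by have /mxOverP/(_ 0 i)/RRe_real := hermitian_spectral_diag_real hA.
rewrite /cdiag_mx dE -(invmx_unitary (spectral_unitarymx A)).
exact/orthomx_spectralP/hermitian_normalmx.
Qed.

Lemma psd_diag_ge0 A i : psd A -> 0 <= A i i.
Proof.
move=> [_ /(_ (delta_mx i 0))].
by rewrite trmx_delta map_delta_mx -rowE -colE !mxE.
Qed.

Lemma psd_mxtrace_ge0 A : psd A -> 0 <= \tr A.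
Proof. by move=> pA; apply: sumr_ge0 => i _; exact: psd_diag_ge0. Qed.

Lemma psd_factor A : psd A -> exists B, A = B^t* *m B.
Proof.
move=> pA; have [U [d [Uu AE]]] := selfadjoint_spectral (psd_selfadjoint pA).
have d0 i : 0 <= d 0 i.
  (* The diagonal of U A U^* is [d]. *)
  have /(psd_diag_ge0 i) := psd_congr (U^t*) pA.
  rewrite trmxCK AE -!mulmxA (unitarymxP Uu) mulmx1 mulmxA (unitarymxP Uu).
  by rewrite mul1mx !mxE eqxx mulr1n lecR.
exists (cdiag_mx (map_mx Num.sqrt d) *m U).
have dE : \row_i (map_mx Num.sqrt d 0 i * map_mx Num.sqrt d 0 i) = d.
  by apply/rowP => i; rewrite !mxE -expr2 sqr_sqrtr.
rewrite trmxC_mul cdiag_mx_adj mulmxA -(mulmxA (U^t*)) mul_cdiag_mx dE.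
exact: AE.
Qed.

(** With P = B^* B and A = C^* C, the trace is the squared Hilbert-Schmidt norm of B C^*, so its
    vanishing forces B C^* = 0. *)
Lemma psd_mxtrace_mul P A : psd P -> psd A ->
  0 <= \tr (P *m A) /\ (\tr (P *m A) = 0 -> P *m A = 0).
Proof.
move=> /psd_factor[B ->] /psd_factor[C ->].
have -> : \tr (B^t* *m B *m (C^t* *m C)) = \tr ((B *m C^t*) *m (B *m C^t*)^t*).
  by rewrite trmxC_mul trmxCK -mulmxA mxtrace_mulC !mulmxA.
split; first exact: mxtrace_gram_ge0.
by move=> /mxtrace_gram_eq0 BC; rewrite mulmxA -(mulmxA _ B) BC mulmx0 mul0mx.
Qed.

Lemma psd_mxtrace_mul_ge0 P A : psd P -> psd A -> 0 <= \tr (P *m A).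
Proof. by move=> pP pA; case: (psd_mxtrace_mul pP pA). Qed.

Lemma psd_mxtrace_mul_eq0 P A :
  psd P -> psd A -> \tr (P *m A) = 0 -> P *m A = 0.
Proof. by move=> pP pA; case: (psd_mxtrace_mul pP pA). Qed.

(* With X = P - Q one has P X + X Q = 0, so tr(P X^2) = - tr(Q X^2); both      *)
(* traces are nonnegative, hence P X^2 = Q X^2 = 0 and X^3 = 0.                *)
Lemma psd_sqrt_unique P Q : psd P -> psd Q -> P *m P = Q *m Q -> P = Q.
Proof.
move=> pP pQ PQ; apply/eqP; rewrite -subr_eq0; apply/eqP; set X := P - Q.
have hX : X^t* = X.
  have /selfadjointP hP := psd_selfadjoint pP.
  have /selfadjointP hQ := psd_selfadjoint pQ.
  by rewrite /X trmxCB hP hQ.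
have pXX : psd (X *m X) by rewrite -{1}hX; exact: psd_gram.
have PX : P *m X = - (X *m Q).
  by rewrite /X mulmxBr mulmxBl PQ opprB.
have trPQ : \tr (P *m (X *m X)) = - \tr (Q *m (X *m X)).
  by rewrite mulmxA PX mulNmx linearN/= -mulmxA mxtrace_mulC mulmxA.
have trP0 : \tr (P *m (X *m X)) = 0.
  by apply/le_anti; rewrite psd_mxtrace_mul_ge0// trPQ oppr_le0 psd_mxtrace_mul_ge0.
have XXX : X *m (X *m X) = 0.
  rewrite {1}/X mulmxBl (psd_mxtrace_mul_eq0 pP pXX)//.
  by rewrite (psd_mxtrace_mul_eq0 pQ pXX) ?subr0// -[LHS]opprK -trPQ trP0 oppr0.
have XX : X *m X = 0.
  by apply: mxtrace_gram_eq0; rewrite trmxC_mul hX -mulmxA XXX mulmx0 linear0.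
by apply: mxtrace_gram_eq0; rewrite hX XX linear0.
Qed.

Lemma mulmx_adj0 P Q : selfadjoint P -> selfadjoint Q -> P *m Q = 0 -> Q *m P = 0.
Proof.
move=> /selfadjointP hP /selfadjointP hQ PQ.
by rewrite -hP -hQ -trmxC_mul PQ trmx0 map_mx0.
Qed.

(** Both cross terms vanish, so P + Q is a positive semidefinite square root of (P - Q)^* (P - Q);
    by uniqueness it is |P - Q|. *)
Lemma trace_norm_sub P Q : psd P -> psd Q -> P *m Q = 0 ->
  trace_norm (P - Q) = complex.Re (\tr (P + Q)).
Proof.
move=> pP pQ PQ; rewrite /trace_norm /absmx /psd_sqrt.
have QP := mulmx_adj0 (psd_selfadjoint pP) (psd_selfadjoint pQ) PQ.
have /selfadjointP hP := psd_selfadjoint pP.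
have /selfadjointP hQ := psd_selfadjoint pQ.
have sqr : (P + Q) *m (P + Q) = (P - Q)^t* *m (P - Q).
  rewrite trmxCB hP hQ !mulmxDl !mulNmx !mulmxDr !mulmxN PQ QP.
  by rewrite !(oppr0, addr0, add0r, opprK).
case: xgetP => [S _ [pS SS]|/(_ (P + Q)) nS].
  congr (complex.Re (\tr _)).
  exact: psd_sqrt_unique pS (psdD pP pQ) (etrans SS (esym sqr)).
by case: nS; split; [exact: psdD pP pQ|exact: sqr].
Qed.

(** In an eigenbasis, take the positive and negative parts of the eigenvalues. *)
Lemma jordan_exists D : selfadjoint D ->
  exists P Q, [/\ psd P, psd Q, P *m Q = 0 & D = P - Q].
Proof.
move=> /selfadjoint_spectral[U [d [Uu DE]]].
pose p := map_mx (fun x => Num.max x 0) d.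
pose q := map_mx (fun x => Num.max (- x) 0) d.
exists (U^t* *m cdiag_mx p *m U), (U^t* *m cdiag_mx q *m U); split.
- by apply/psd_congr/psd_cdiag => i; rewrite mxE le_max lexx orbT.
- by apply/psd_congr/psd_cdiag => i; rewrite mxE le_max lexx orbT.
- rewrite !mulmxA -(mulmxA _ U) (unitarymxP Uu) mulmx1.
  rewrite -(mulmxA (U^t*)) mul_cdiag_mx.
  suff -> : \row_i (p 0 i * q 0 i) = 0.
    by rewrite /cdiag_mx map_mx0 linear0 mulmx0 mul0mx.
  apply/rowP => i; rewrite !mxE; case: (leP 0 (d 0 i)) => d0.
    by rewrite (max_r (x := - _)) ?mulr0// oppr_le0.
  by rewrite mul0r.
- have dE : p - q = d.
    apply/rowP => i; rewrite !mxE; case: (leP 0 (d 0 i)) => d0.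
      by rewrite (max_r (x := - _)) ?subr0// oppr_le0.
    by rewrite max_l ?opprK ?add0r// oppr_ge0 ltW.
  by rewrite -mulmxBl -mulmxBr -linearB/= -map_mxB dE.
Qed.

Lemma jordan_partsP D : selfadjoint D ->
  [/\ psd (pos_part_mx D), psd (neg_part_mx D),
      pos_part_mx D *m neg_part_mx D = 0 & D = pos_part_mx D - neg_part_mx D].
Proof.
move=> hD; rewrite /pos_part_mx /neg_part_mx /jordan_parts.
case: xgetP => [B _ //|noB]; have [P [Q PQ]] := jordan_exists hD.
by case: (noB (P, Q)).
Qed.

(** The projection p satisfies p = X A for some X, and p A^* = A^*. Hence p p^* = p A^* X^* = A^*
    X^* = p^*, and p p^* is its own adjoint. *)
Lemma support_proj_selfadjoint A : (support_proj A)^t* = support_proj A.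
Proof.
rewrite /support_proj; set p := proj_ortho A.
have /submxP[X pE] : (p <= A)%MS by rewrite /p proj_orthoE.
have : (1%:M - 1%:M *m p) *m A^t* = 0 by apply/orthomx1P/proj_ortho_compl_sub.
rewrite mul1mx mulmxBl mul1mx => /subr0_eq pA.
have pp : p *m p^t* = p^t* by rewrite {2 3}pE trmxC_mul mulmxA -pA.
by rewrite -{2}[p]trmxCK -{2}pp [RHS]trmxC_mul trmxCK pp.
Qed.

Lemma support_proj_idem A : support_proj A *m support_proj A = support_proj A.
Proof. exact: proj_ortho_proj. Qed.

Lemma mulmx_support_proj A : A *m support_proj A = A.
Proof. exact/proj_ortho_id/submx_refl. Qed.

Lemma support_proj_mulmx A : selfadjoint A -> support_proj A *m A = A.
Proof.
move=> /selfadjointP hA.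
by rewrite -{2}hA -support_proj_selfadjoint -trmxC_mul mulmx_support_proj hA.
Qed.

Lemma support_proj_mul0 A B : A *m B = 0 -> support_proj A *m B = 0.
Proof.
move=> AB; have /submxP[X ->] : (support_proj A <= A)%MS by rewrite proj_orthoE.
by rewrite -mulmxA AB mulmx0.
Qed.

Lemma psd_support_proj A : psd (support_proj A).
Proof.
by rewrite -support_proj_idem -{1}support_proj_selfadjoint; exact: psd_gram.
Qed.

Lemma psd_support_projC A : psd (1%:M - support_proj A).
Proof.
have -> : 1%:M - support_proj A = (1%:M - support_proj A)^t* *m (1%:M - support_proj A).
  rewrite trmxCB support_proj_selfadjoint trmx1 map_mx1.
  by rewrite mulmxBl mul1mx mulmxBr mulmx1 support_proj_idem subrr subr0.
exact: psd_gram.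
Qed.

(** If the trace vanishes then P A = A P = 0, so the support projection s of A kills P. Conversely A
    = s A s, and cyclicity gives tr(P A) = tr(s P s A). *)
Lemma psd_mxtrace_support P A : psd P -> psd A ->
  \tr (P *m A) = 0 <-> support_proj A *m P *m support_proj A = 0.
Proof.
move=> pP pA; have hA := psd_selfadjoint pA; split=> [trPA|sPs].
  have PA := psd_mxtrace_mul_eq0 pP pA trPA.
  have AP := mulmx_adj0 (psd_selfadjoint pP) hA PA.
  by rewrite (support_proj_mul0 AP) mul0mx.
have sAs : A = support_proj A *m A *m support_proj A.
  by rewrite support_proj_mulmx// mulmx_support_proj.
move: sAs sPs; move: (support_proj A) => s sAs sPs.
by rewrite {1}sAs mulmxA mxtrace_mulC !mulmxA sPs mul0mx linear0.
Qed.

Lemma trace_norm_traceless D : selfadjoint D -> \tr D = 0 ->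
  \tr (pos_part_mx D) = (2^-1 * trace_norm D)%:C /\
  \tr (neg_part_mx D) = (2^-1 * trace_norm D)%:C.
Proof.
move=> hD trD; have [pP pQ PQ DE] := jordan_partsP hD.
have trPQ : \tr (pos_part_mx D) = \tr (neg_part_mx D).
  by apply/eqP; rewrite -subr_eq0 -linearB/= -DE trD.
suff trP : \tr (pos_part_mx D) = (2^-1 * trace_norm D)%:C by rewrite -trPQ.
rewrite {2}DE trace_norm_sub// linearD/= -trPQ.
(* The trace is real, so passing to [complex.Re] in [trace_norm] is harmless. *)
have /ger0_real/complex_realP[t ->] := psd_mxtrace_ge0 pP.
by congr (_ +i* _); rewrite /=; lra.
Qed.

(** The Jordan decomposition has the least positive part in trace: with s the support projection of
    D_+, tr D_+ = tr(s D) = tr(s P) - tr(s Q), which is at most tr P. This bounds trace distances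
    from decompositions that need not be orthogonal. *)
Lemma trace_norm_traceless_le P Q : psd P -> psd Q -> \tr (P - Q) = 0 ->
  (2^-1 * trace_norm (P - Q))%:C <= \tr P.
Proof.
move=> pP pQ trPQ; set D := P - Q.
have hD : selfadjoint D.
  have := selfadjoint_lin 1 (-1) (psd_selfadjoint pP) (psd_selfadjoint pQ).
  by rewrite rmorphN rmorph1 scaleN1r scale1r.
have [pD nD DD DE] := jordan_partsP hD.
have [<- _] := trace_norm_traceless hD trPQ.
set s := support_proj (pos_part_mx D).
have sD : s *m D = pos_part_mx D.
  rewrite [X in _ *m X]DE mulmxBr (support_proj_mulmx (psd_selfadjoint pD)).
  by rewrite support_proj_mul0// subr0.
rewrite -sD /D mulmxBr linearB/= lerBlDr -subr_ge0.
have -> : \tr P + \tr (s *m Q) - \tr (s *m P) = \tr ((1%:M - s) *m P) + \tr (s *m Q).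
  by rewrite mulmxBl mul1mx linearB/= addrAC.
exact: addr_ge0 (psd_mxtrace_mul_ge0 (psd_support_projC _) pP)
  (psd_mxtrace_mul_ge0 (psd_support_proj _) pQ).
Qed.

End PositiveMatrices.

(** * Extreme eigenvalues and perturbation of positive definite matrices *)

Section Eigenvalues.
Context {R : realType} {n : nat}.
Implicit Types (A B P Q D : 'M[R[i]]_n) (d e : 'rV[R]_n).

Lemma delta_mul_cdiag_mx i d :
  delta_mx (0 : 'I_1) i *m cdiag_mx d = (d 0 i)%:C *: delta_mx 0 i.
Proof. by rewrite -rowE row_diag_mx mxE. Qed.

Lemma spectral_eigenvalue A U d x : U \is unitarymx ->
  A = U^t* *m cdiag_mx d *m U -> eigenvalue A x%:C <-> exists i, x = d 0 i.
Proof.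
move=> Uu AE; split=> [/eigenvalueP[v vA v0]|[i ->]].
  (* [w] is a row eigenvector of the diagonal matrix; any nonzero coordinate of it identifies [x]
     with a diagonal entry. *)
  set w := v *m U^t*.
  have w0 : w != 0.
    apply: contraNneq v0 => w0.
    by rewrite -(mulmxKtV v Uu)// -/w w0 mul0mx.
  have wD : w *m cdiag_mx d = x%:C *: w.
    rewrite /w scalemxAl -vA AE -!mulmxA (unitarymxP Uu) mulmx1.
    by rewrite mulmxA.
  clearbody w; have [i wi0] := rV0Pn _ w0; exists i.
  have /eqP := congr1 (fun u : 'rV_n => u 0 i) wD.
  rewrite mul_mx_diag !mxE mulrC -subr_eq0 -mulrBl mulf_eq0 (negPf wi0) orbF.
  by rewrite subr_eq0 => /eqP/complexI ->.
apply/eigenvalueP; exists (row i U).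
  rewrite AE rowE !mulmxA -(mulmxA _ U) (unitarymxP Uu) mulmx1.
  by rewrite delta_mul_cdiag_mx -scalemxAl.
have /row_unitarymxP/(_ i i) := Uu; apply: contra_eq_neq => ->.
by rewrite linear0l eqxx eq_sym oner_eq0.
Qed.

(** The supremum is the largest entry d_k of a spectral diagonal: d_k - A is unitarily congruent to
    a nonnegative diagonal matrix, and row k of the unitary is the unit eigenvector. *)
Lemma max_eigenvalueP A : (0 < n)%N -> selfadjoint A ->
  psd ((max_eigenvalue A)%:C%:M - A) /\
  exists v : 'rV[R[i]]_n, v *m A = (max_eigenvalue A)%:C *: v /\ v *m v^t* = 1%:M.
Proof.
move=> n0 hA; have [U [d [Uu AE]]] := selfadjoint_spectral hA.
have [k dk] : exists k, forall i, d 0 i <= d 0 k.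
  pose i0 := Ordinal n0; exists [arg max_(i > i0) d 0 i]%O.
  by case: arg_maxP => // k _ dk i; exact: dk.
have -> : max_eigenvalue A = d 0 k.
  apply/le_anti/andP; split.
    apply: ge_sup; first by exists (d 0 k); apply/(spectral_eigenvalue _ Uu AE); exists k.
    by move=> x /= /(spectral_eigenvalue _ Uu AE)[i ->].
  apply: ub_le_sup; last by apply/(spectral_eigenvalue _ Uu AE); exists k.
  by exists (d 0 k) => x /= /(spectral_eigenvalue _ Uu AE)[i ->].
split.
  have -> : (d 0 k)%:C%:M - A = U^t* *m cdiag_mx (const_mx (d 0 k) - d) *m U.
    rewrite AE /cdiag_mx map_mxB linearB/= mulmxBr mulmxBl map_const_mx diag_const_mx.
    rewrite mul_mx_scalar -scalemxAl -(invmx_unitary Uu) mulVmx ?unitarymx_unit//.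
    by rewrite scalemx1.
  by apply/psd_congr/psd_cdiag => i; rewrite !mxE subr_ge0.
exists (row k U); split.
  rewrite AE rowE !mulmxA -(mulmxA _ U) (unitarymxP Uu) mulmx1.
  by rewrite delta_mul_cdiag_mx -scalemxAl.
rewrite !rowE trmxC_mul !mulmxA -(mulmxA _ U) (unitarymxP Uu) mulmx1.
by rewrite trmx_delta map_delta_mx mul_delta_mx; apply/matrixP => i j; rewrite !mxE !ord1.
Qed.

Lemma min_eigenvalueE A : min_eigenvalue A = - max_eigenvalue (- A).
Proof.
have eN B x : eigenvalue B x -> eigenvalue (- B) (- x).
  move=> /eigenvalueP[v vB v0]; apply/eigenvalueP; exists v => //.
  by rewrite mulmxN vB scaleNr.
rewrite /min_eigenvalue /max_eigenvalue /inf; congr (- sup _).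
apply/seteqP; split=> [_ [x /= xA] <-|x /= xA]; first by rewrite rmorphN; exact: (eN A).
exists (- x); last exact: opprK.
by have := eN _ _ xA; rewrite opprK /= rmorphN.
Qed.

Lemma min_eigenvalueP A : (0 < n)%N -> selfadjoint A ->
  psd (A - (min_eigenvalue A)%:C%:M) /\
  exists v : 'rV[R[i]]_n, v *m A = (min_eigenvalue A)%:C *: v /\ v *m v^t* = 1%:M.
Proof.
move=> n0 hA; have hNA : selfadjoint (- A).
  by have := selfadjoint_lin (-1) 0 hA hA; rewrite scale0r addr0 rmorphN scaleN1r.
have [pNA [v [vA v1]]] := max_eigenvalueP n0 hNA.
rewrite min_eigenvalueE rmorphN; split.
  by rewrite (_ : _ - _ = (max_eigenvalue (- A))%:C%:M - - A)// raddfN/= !opprK addrC.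
by exists v; split=> //; rewrite -[A in LHS]opprK mulmxN vA scaleNr.
Qed.

Lemma psd_scalar (a : R) : 0 <= a -> psd (a%:C%:M : 'M[R[i]]_n).
Proof.
move=> a0; rewrite -scalemx1; apply: psdZ => //.
by have := psd_gram (1%:M : 'M[R[i]]_n); rewrite mulmx1 trmx1 map_mx1.
Qed.

Lemma posdef_min_eigenvalue_gt0 A : (0 < n)%N -> posdef A -> 0 < min_eigenvalue A.
Proof.
move=> n0 [hA pA]; have [_ [v [vA v1]]] := min_eigenvalueP n0 hA.
have /pA : v^t* != 0.
  apply: contra_eq_neq v1 => ->; rewrite mulmx0 eq_sym.
  by apply/eqP => /matrixP/(_ 0 0)/eqP; rewrite !mxE oner_eq0.
by rewrite trmxCK vA -scalemxAl v1 !mxE mulr1 ltcR.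
Qed.

(** With m > 0 and k the least eigenvalues of A and B, A + t B dominates (m + t k) times the
    identity. *)
Lemma posdef_perturbation A B : (0 < n)%N -> posdef A -> selfadjoint B ->
  exists2 r : R, 0 < r & forall t, 0 < t < r -> psd (A + t%:C *: B).
Proof.
move=> n0 pA hB; have m0 := posdef_min_eigenvalue_gt0 n0 pA.
have [pAm _] := min_eigenvalueP n0 (proj1 pA).
have [pBm _] := min_eigenvalueP n0 hB.
move: (min_eigenvalue A) (min_eigenvalue B) m0 pAm pBm => m k m0 pAm pBm.
 have k1 : 0 < 1 + `|k| by rewrite ltr_pwDl.
(* Below this radius t |k| < m; adding 1 keeps the denominator positive when k = 0. *)
exists (m / (1 + `|k|)); first exact: divr_gt0.
move=> t /andP[t0]; rewrite (ltr_pdivlMr _ _ k1) => tm.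
have mtk : 0 <= m + t * k.
  have tk : - (t * k) <= t * (1 + `|k|).
    by rewrite -mulrN ler_pM2l// -normrN (le_trans (ler_norm _))// lerDr.
  by rewrite -[t * k]opprK subr_ge0 (le_trans tk)// ltW.
have -> : A + t%:C *: B = (A - m%:C%:M) + t%:C *: (B - k%:C%:M) + (m + t * k)%:C%:M.
  apply/matrixP => i j; rewrite !mxE rmorphD rmorphM/=.
  by case: (i == j); rewrite ?mulr1n ?mulr0n; ring.
apply: psdD; last exact: psd_scalar.
exact: psdD pAm (psdZ (ltW t0) pBm).
Qed.

End Eigenvalues.

(** * Hermitian real and imaginary parts of a matrix *)

Section CartesianDecomposition.
Context {C : numClosedFieldType} {n : nat}.
Implicit Types X Y : 'M[C]_n.

Definition herm_re X : 'M[C]_n := 2^-1 *: (X + X^t*).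
Definition herm_im X : 'M[C]_n := (2^-1 * 'i) *: (X^t* - X).

Lemma conjC_half : (2^-1 : C)^*%R = 2^-1.
Proof. by rewrite fmorphV rmorph_nat. Qed.

Lemma herm_re_adj X : (herm_re X)^t* = herm_re X.
Proof. by rewrite /herm_re trmxCZ trmxCD trmxCK conjC_half addrC. Qed.

Lemma herm_im_adj X : (herm_im X)^t* = herm_im X.
Proof.
rewrite /herm_im trmxCZ trmxCB trmxCK rmorphM /= conjC_half conjCi mulrN scaleNr.
by rewrite -scalerN opprB.
Qed.

Lemma herm_re_id X : X^t* = X -> herm_re X = X.
Proof.
move=> hX; rewrite /herm_re hX scalerDr -scalerDl.
by rewrite (_ : 2^-1 + 2^-1 = 1) ?scale1r// [RHS]splitr mul1r.
Qed.

Lemma herm_im_id X : X^t* = X -> herm_im X = 0.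
Proof. by move=> hX; rewrite /herm_im hX subrr scaler0. Qed.

Lemma herm_re_trmxC X : herm_re (X^t*) = herm_re X.
Proof. by rewrite /herm_re trmxCK addrC. Qed.

Lemma herm_im_trmxC X : herm_im (X^t*) = - herm_im X.
Proof. by rewrite /herm_im trmxCK -scalerN opprB. Qed.

Lemma herm_reD X Y : herm_re (X + Y) = herm_re X + herm_re Y.
Proof. by rewrite /herm_re trmxCD addrACA scalerDr. Qed.

Lemma herm_imD X Y : herm_im (X + Y) = herm_im X + herm_im Y.
Proof. by rewrite /herm_im trmxCD opprD addrACA scalerDr. Qed.

Lemma herm_reZ c X : herm_re (c *: X) = 'Re c *: herm_re X - 'Im c *: herm_im X.
Proof.
rewrite /herm_re /herm_im trmxCZ {1 2}[c]Crect conjC_rect ?Creal_Re ?Creal_Im//.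
move: ('Re c) ('Im c) 'i%R (X^t*) => a b I Y.
by apply/matrixP => i j; rewrite !mxE; ring.
Qed.

Lemma herm_imZ c X : herm_im (c *: X) = 'Re c *: herm_im X + 'Im c *: herm_re X.
Proof.
rewrite /herm_re /herm_im trmxCZ {1 2}[c]Crect conjC_rect ?Creal_Re ?Creal_Im//.
have := sqrCi C; move: ('Re c) ('Im c) 'i%R (X^t*) => a b I Y II.
apply/matrixP => i j; rewrite !mxE.
(* The square of the imaginary unit is isolated so that it can be replaced by -1 between two ring
   identities. *)
transitivity (2^-1 * (I * a * (Y i j - X i j) - I ^+ 2 * b * (Y i j + X i j))).
  by ring.
by rewrite II; ring.
Qed.

End CartesianDecomposition.

(** * Existence of the gradient; directional derivatives and concavity *)

Section Gradient.
Context {R : realType} {n : nat}.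
Implicit Types (G X Y h x y : 'M[R[i]]_n) (f : 'M[R[i]]_n -> R).

(* A real-linear functional on the self-adjoint matrices extends complex      *)
(* linearly to all matrices; evaluating it on matrix units gives G.           *)
Lemma selfadjoint_riesz (L : 'M[R[i]]_n -> R) :
  (forall (a b : R) h k, selfadjoint h -> selfadjoint k ->
     L (a%:C *: h + b%:C *: k) = a * L h + b * L k) ->
  exists G, selfadjoint G /\
    forall h, selfadjoint h -> \tr (G *m h) = (L h)%:C.
Proof.
move=> Llin; pose LC X : R[i] := (L (herm_re X))%:C + 'i%R * (L (herm_im X))%:C.
have hre X : selfadjoint (herm_re X) by apply/selfadjointP/herm_re_adj.
have him X : selfadjoint (herm_im X) by apply/selfadjointP/herm_im_adj.
have LD h k : selfadjoint h -> selfadjoint k -> L (h + k) = L h + L k.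
  by move=> hh hk; have := Llin 1 1 h k hh hk; rewrite !scale1r !mul1r.
have rectD (u v w s : R) : (u + v)%:C + 'i%R * (w + s)%:C =
    u%:C + 'i%R * w%:C + (v%:C + 'i%R * s%:C).
  by rewrite !(rmorphD (real_complex R)) mulrDr addrACA.
have rectM (a b u v : R) : (a * u - b * v)%:C + 'i%R * (a * v + b * u)%:C =
    (a%:C + 'i%R * b%:C) * (u%:C + 'i%R * v%:C).
  rewrite (rmorphB (real_complex R)) (rmorphD (real_complex R)).
  rewrite !(rmorphM (real_complex R)).
  rewrite /=; have := sqrCi R[i]; move: 'i%R a%:C b%:C u%:C v%:C => I x y z w II.
  transitivity (x * z + I ^+ 2 * y * w + I * (x * w + y * z)); last by ring.
  by rewrite II; ring.
have LCD X Y : LC (X + Y) = LC X + LC Y.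
  rewrite /LC herm_reD herm_imD; etransitivity; last exact: rectD.
  by congr (_%:C + _ * _%:C); exact: LD.
have LCZ c X : LC (c *: X) = c * LC X.
  rewrite /LC herm_reZ herm_imZ [c in RHS]Crect -complexRe -complexIm.
  rewrite -scaleNr -(rmorphN (real_complex R)).
  etransitivity; last exact: rectM.
  congr (_%:C + _ * _%:C); last exact: Llin.
  by rewrite -mulNr; exact: Llin.
have LC0 : LC 0 = 0 by rewrite -(scale0r 0) LCZ mul0r.
(* This symmetry makes the matrix of values of [LC] self-adjoint. *)
have LCadj X : (LC X)^*%R = LC (X^t*).
  rewrite /LC conjC_rect; [|by rewrite complex_real..].
  rewrite herm_re_trmxC herm_im_trmxC.
  have := Llin (-1) 0 _ _ (him X) (him X).
  rewrite scale0r addr0 rmorphN scaleN1r mul0r addr0 mulN1r => ->.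
  by rewrite rmorphN mulrN.
(* The indices are swapped because tr(G h) pairs G_ij with h_ji. *)
exists (\matrix_(i, j) LC (delta_mx j i)); split.
  apply/selfadjointP/matrixP => i j; rewrite !mxE LCadj.
  by rewrite trmx_delta map_delta_mx.
move=> h hh; transitivity (LC h).
  rewrite [in RHS](matrix_sum_delta h) (big_morph LC LCD LC0).
  under [RHS]eq_bigr do rewrite (big_morph LC LCD LC0).
  rewrite exchange_big; apply: eq_bigr => i _; rewrite mxE.
  by apply: eq_bigr => j _; rewrite !mxE LCZ mulrC.
have L0 : L 0 = 0.
  have := Llin 0 0 _ _ (hre 0) (hre 0).
  by rewrite rmorph0 !scale0r addr0 !mul0r addr0.
move/selfadjointP : hh => hh.
by rewrite /LC herm_re_id// herm_im_id// L0 rmorph0 mulr0 addr0.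
Qed.

Lemma gradientP f x : gateaux_differentiable f x ->
  selfadjoint (gradient f x) /\
  forall h, selfadjoint h ->
    \tr (gradient f x *m h) = (dir_derivative f x h)%:C.
Proof.
move=> [_ flin _]; rewrite /gradient; case: xgetP => [G _ //|noG].
by have [G /noG] := selfadjoint_riesz flin.
Qed.

(** By concavity every difference quotient with 0 < t <= 1 is already at least f y - f x; this
    passes to the limit. *)
Lemma concave_dir_derivative_ge f (K : set 'M[R[i]]_n) x y :
  concave_on K f -> K x -> K y ->
  cvg (diff_quotient f x (y - x) t @[t --> (0 : R)^'+]) ->
  f y - f x <= dir_derivative f x (y - x).
Proof.
move=> fK Kx Ky fcvg; apply: limr_ge => //.
near=> t; have t0 : 0 < t by near: t; exact: nbhs_right_gt.
have t1 : t <= 1 by near: t; apply: nbhs_right_ltW.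
rewrite /diff_quotient mulrC ler_pdivlMr//.
have := fK y x t Ky Kx; rewrite (ltW t0) t1 => /(_ isT).
have -> : t%:C *: y + (1 - t)%:C *: x = x + t%:C *: (y - x).
  by rewrite rmorphB rmorph1 scalerBl scale1r scalerBr addrCA.
lra.
Unshelve. all: by end_near. Qed.

Lemma dir_derivative_le0 f x h (r : R) : 0 < r ->
  (forall t, 0 < t < r -> f (x + t%:C *: h) <= f x) ->
  cvg (diff_quotient f x h t @[t --> (0 : R)^'+]) ->
  dir_derivative f x h <= 0.
Proof.
move=> r0 fx fcvg; apply: limr_le => //.
near=> t; have t0 : 0 < t by near: t; exact: nbhs_right_gt.
have tr : t < r by near: t; exact: nbhs_right_lt.
by rewrite /diff_quotient pmulr_rle0 ?invr_gt0// subr_le0 fx// t0.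
Unshelve. all: by end_near. Qed.

End Gradient.

(** * The gap identity, its equality case, and feasible segments *)

Section OptimalityGap.
Context {R : realType} {n : nat}.
Implicit Types (A B G D V W : 'M[R[i]]_n).

Lemma states_dim_gt0 A : states A -> (0 < n)%N.
Proof.
move=> [_ trA]; rewrite lt0n; apply/eqP => n0; subst n.
by move: trA; rewrite /mxtrace big_ord0 => /eqP; rewrite eq_sym oner_eq0.
Qed.

Lemma statesB A B : states A -> states B -> selfadjoint (A - B) /\ \tr (A - B) = 0.
Proof.
move=> [[hA _] trA] [[hB _] trB]; split; first exact: selfadjointB.
by rewrite linearB/= trA trB subrr.
Qed.

Lemma min_le_max_eigenvalue G : (0 < n)%N -> selfadjoint G ->
  min_eigenvalue G <= max_eigenvalue G.
Proof.
move=> n0 hG; have [pM _] := max_eigenvalueP n0 hG.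
have [pm _] := min_eigenvalueP n0 hG.
have := psd_diag_ge0 (Ordinal n0) (psdD pM pm).
by rewrite addrA subrK !mxE eqxx !mulr1n subr_ge0 lecR.
Qed.

(** If both extremes equal m, then G - m and m - G are positive semidefinite, so G - m has trace
    zero and vanishes. Conversely, a scalar matrix has only one eigenvalue. *)
Lemma eq_extreme_eigenvalues G : (0 < n)%N -> selfadjoint G ->
  max_eigenvalue G = min_eigenvalue G <-> exists l : R, G = (l%:C)%:M.
Proof.
move=> n0 hG; have [pM [v [vG v1]]] := max_eigenvalueP n0 hG.
have [pm [w [wG w1]]] := min_eigenvalueP n0 hG; split=> [Mm|[l Gl]].
  exists (max_eigenvalue G); rewrite Mm in pM *.
  apply/eqP; rewrite -subr_eq0; apply/eqP.
  rewrite -[LHS]mulmx1; apply: (psd_mxtrace_mul_eq0 pm (psd_scalar ler01)).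
  rewrite mulmx1; apply/le_anti; rewrite (psd_mxtrace_ge0 pm) andbT.
  by rewrite -oppr_ge0 -linearN/= opprB psd_mxtrace_ge0.
have ev (u : 'rV_n) (x : R) : u *m G = x%:C *: u -> u *m u^t* = 1%:M -> x = l.
  move=> uG u1; have := congr1 (fun z => (z *m u^t*) 0 0) uG.
  by rewrite Gl mul_mx_scalar -!scalemxAl u1 !mxE !mulr1 => /complexI ->.
by rewrite (ev v _ vG v1) (ev w _ wG w1).
Qed.

(** Both Jordan parts have trace t, half the trace norm. The last two terms thus sum to t (M - m) -
    tr(G D), and the first one cancels the dependence on t. *)
Lemma optimality_gap G D (eps : R) : selfadjoint D -> \tr D = 0 ->
  (eps * (max_eigenvalue G - min_eigenvalue G))%:C - \tr (G *m D) =
  ((eps - 2^-1 * trace_norm D) * (max_eigenvalue G - min_eigenvalue G))%:C +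
  \tr (((max_eigenvalue G)%:C%:M - G) *m pos_part_mx D) +
  \tr ((G - (min_eigenvalue G)%:C%:M) *m neg_part_mx D).
Proof.
move=> hD trD; have [tP tN] := trace_norm_traceless hD trD.
have [_ _ _ DE] := jordan_partsP hD.
move: (max_eigenvalue G) (min_eigenvalue G) => M m.
have -> : \tr (G *m D) = \tr (G *m pos_part_mx D) - \tr (G *m neg_part_mx D).
  by rewrite {1}DE mulmxBr linearB.
have -> : \tr ((M%:C%:M - G) *m pos_part_mx D) =
    M%:C * (2^-1 * trace_norm D)%:C - \tr (G *m pos_part_mx D).
  by rewrite mulmxBl mul_scalar_mx linearB/= linearZ/= tP.
have -> : \tr ((G - m%:C%:M) *m neg_part_mx D) =
    \tr (G *m neg_part_mx D) - m%:C * (2^-1 * trace_norm D)%:C.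
  by rewrite mulmxBl mul_scalar_mx linearB/= linearZ/= tN.
move: (2^-1 * trace_norm D) => t.
rewrite !(rmorphM (real_complex R)) !(rmorphB (real_complex R))/=.
by move: (\tr _) (\tr _) M%:C m%:C t%:C eps%:C => p q x y z e; ring.
Qed.

Lemma optimality_gap_eq0 G D (eps : R) : (0 < n)%N -> selfadjoint G ->
  selfadjoint D -> \tr D = 0 -> 2^-1 * trace_norm D <= eps ->
  \tr (G *m D) <= (eps * (max_eigenvalue G - min_eigenvalue G))%:C /\
  (\tr (G *m D) = (eps * (max_eigenvalue G - min_eigenvalue G))%:C <->
   [/\ 2^-1 * trace_norm D = eps \/ max_eigenvalue G = min_eigenvalue G,
       \tr (((max_eigenvalue G)%:C%:M - G) *m pos_part_mx D) = 0
     & \tr ((G - (min_eigenvalue G)%:C%:M) *m neg_part_mx D) = 0]).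
Proof.
move=> n0 hG hD trD De; have [pP pN _ _] := jordan_partsP hD.
have [pM _] := max_eigenvalueP n0 hG; have [pm _] := min_eigenvalueP n0 hG.
have gap := optimality_gap G eps hD trD.
have := psd_mxtrace_mul_ge0 pM pP; have := psd_mxtrace_mul_ge0 pm pN.
have : 0 <= ((eps - 2^-1 * trace_norm D) *
             (max_eigenvalue G - min_eigenvalue G))%:C :> R[i].
  by rewrite lecR mulr_ge0 ?subr_ge0 ?min_le_max_eigenvalue.
have eqC : ((eps - 2^-1 * trace_norm D) * (max_eigenvalue G - min_eigenvalue G))%:C
    = 0 :> R[i] <-> 2^-1 * trace_norm D = eps \/ max_eigenvalue G = min_eigenvalue G.
  split=> [/complexI/eqP|e].
    by rewrite mulf_eq0 !subr_eq0 => /orP[/eqP->|/eqP]; [left|right].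
  by case: e => ->; rewrite subrr ?mul0r ?mulr0.
move: eqC gap.
set a := (_ * _)%:C; set p := \tr (_ *m pos_part_mx D).
set q := \tr (_ *m neg_part_mx D); set b := (eps * _)%:C; set g := \tr _.
move=> eqC gap a0 q0 p0; split.
  by rewrite -subr_ge0 gap !addr_ge0.
split=> [gb|[/eqC ap pp qq]].
  move: gap; rewrite gb subrr => /esym/eqP.
  rewrite paddr_eq0 ?addr_ge0// => /andP[+ /eqP q1].
  by rewrite paddr_eq0// => /andP[/eqP/eqC ? /eqP p1].
by apply/esym/eqP; rewrite -subr_eq0 gap ap pp qq !addr0.
Qed.

(** Idempotence makes x times the projection the compression of the scalar x; this puts the output
    of [psd_mxtrace_support] into the form of condition 3. *)
Lemma compression_eq P G (x : R) :
  support_proj P *m (x%:C%:M - G) *m support_proj P = 0 <->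
  support_proj P *m G *m support_proj P = x%:C *: support_proj P.
Proof.
rewrite mulmxBr mulmxBl mul_mx_scalar -scalemxAl support_proj_idem.
by split=> [/subr0_eq->//|->]; rewrite subrr.
Qed.

Lemma compression_eqN P G (x : R) :
  support_proj P *m (G - x%:C%:M) *m support_proj P = 0 <->
  support_proj P *m G *m support_proj P = x%:C *: support_proj P.
Proof.
rewrite mulmxBr mulmxBl mul_mx_scalar -scalemxAl support_proj_idem.
by split=> [/subr0_eq|->]; rewrite ?subrr.
Qed.

(* Positive definiteness of A keeps the short segment towards the possibly    *)
(* non-positive B + eps (V - W) inside the state space.                       *)
Lemma trace_ball_segment (eps : R) A B V W : 0 < eps ->
  states B -> posdef_trace_ball eps B A ->
  psd V -> psd W -> \tr V = 1 -> \tr W = 1 ->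
  exists2 r : R, 0 < r & forall t, 0 < t < r ->
    trace_ball eps B (A + t%:C *: (B + eps%:C *: (V - W) - A)).
Proof.
move=> eps0 sB [[sA Ae] [_ pA]] pV pW tV tW.
have n0 := states_dim_gt0 sA.
set H := B + eps%:C *: (V - W) - A.
have hH : selfadjoint H.
  have -> : H = eps%:C *: (V - W) + (-1)%:C *: (A - B).
    by rewrite /H rmorphN rmorph1 scaleN1r opprB addrCA addrA.
  apply: selfadjoint_lin (statesB sA sB).1.
  exact: selfadjointB (psd_selfadjoint pV) (psd_selfadjoint pW).
have [r r0 rP] := posdef_perturbation n0 pA hH.
(* The cap at 1 keeps the weight 1 - t nonnegative. *)
exists (Num.min r 1); first by rewrite lt_min r0 ltr01.
move=> t /andP[t0]; rewrite lt_min => /andP[tr t1].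
have [hD trD] := statesB sA sB.
have trH : \tr H = 0.
  rewrite /H linearB/= linearD/= linearZ/= linearB/= tV tW subrr mulr0 addr0.
  by case: sA => _ ->; case: sB => _ ->; rewrite subrr.
split.
  split; first by apply: (rP t); rewrite t0.
  by rewrite linearD/= linearZ/= trH mulr0 addr0; case: sA.
have [pP pN _ DE] := jordan_partsP hD; have [tP _] := trace_norm_traceless hD trD.
(* The moved point minus B is (1 - t)(A - B) + t eps (V - W) = P - Q. This splitting need not be
   orthogonal, but tr P <= (1 - t) eps + t eps = eps suffices. *)
set P := (1 - t)%:C *: pos_part_mx (A - B) + (t * eps)%:C *: V.
set Q := (1 - t)%:C *: neg_part_mx (A - B) + (t * eps)%:C *: W.
have PQ : A + t%:C *: H - B = P - Q.
  rewrite /P /Q opprD addrACA -!scalerBr -DE /H.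
  rewrite (rmorphB (real_complex R)) (rmorphM (real_complex R)) rmorph1 /=.
  rewrite -[in RHS]scalerA.
  move: (eps%:C *: (V - W)) t%:C => K s.
  by apply/matrixP => i j; rewrite !mxE /=; ring.
have trPQ : \tr (P - Q) = 0.
  rewrite -PQ linearB/= linearD/= linearZ/= trH mulr0 addr0.
  by case: sA => _ ->; case: sB => _ ->; rewrite subrr.
have te : 0 <= t * eps by rewrite mulr_ge0 ?ltW.
have t1' : 0 <= 1 - t by rewrite subr_ge0 ltW.
rewrite PQ -lecR; apply: le_trans (trace_norm_traceless_le
  (psdD (psdZ t1' pP) (psdZ te pV)) (psdD (psdZ t1' pN) (psdZ te pW)) trPQ) _.
rewrite /P linearD/= !linearZ/= tP tV mulr1 -!rmorphM -rmorphD lecR.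
by have := ler_wpM2l t1' Ae; lra.
Qed.

End OptimalityGap.

(** * The inequality and the three equivalent conditions *)

Theorem theorem6p4 (R : realType) (n : nat) (f : 'M[R[i]]_n -> R)
    (f_concave : concave_on states f)
    (f_continuous : {within states, continuous f})
    (f_differentiable : forall x, posdef_states x -> gateaux_differentiable f x)
    (sigma : 'M[R[i]]_n) (sigma_state : states sigma)
    (eps : R) (eps_gt0 : 0 < eps) (eps_le1 : eps <= 1)
    (rho : 'M[R[i]]_n) (rho_ball : posdef_trace_ball eps sigma rho) :
  let G := gradient f rho in
  let bound := eps * (max_eigenvalue G - min_eigenvalue G) in
  let pi_pos := support_proj (pos_part_mx (rho - sigma)) in
  let pi_neg := support_proj (neg_part_mx (rho - sigma)) in
  let cond1 := \tr (G *m (rho - sigma)) = bound%:C in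
  let cond2 := argmax (trace_ball eps sigma) f rho in
  let cond3 :=
    (2^-1 * trace_norm (rho - sigma) = eps \/
       exists lambda : R, G = (lambda%:C)%:M) /\
    (pi_pos *m G *m pi_pos = (max_eigenvalue G)%:C *: pi_pos /\
     pi_neg *m G *m pi_neg = (min_eigenvalue G)%:C *: pi_neg) in
  \tr (G *m (rho - sigma)) <= bound%:C /\
  (cond1 <-> cond2) /\ (cond2 <-> cond3).
Proof.
move=> G bound pi_pos pi_neg cond1 cond2 cond3.
have [[rho_state rho_eps] rho_pos] := rho_ball.
have n0 := states_dim_gt0 rho_state.
have f_diff := f_differentiable _ rho_pos.
have [hG dirG] := gradientP f_diff.
have f_cvg : forall h, selfadjoint h ->
    cvg (diff_quotient f rho h t @[t --> (0 : R)^'+]) by case: f_diff.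
(* The bound is needed at every state of the ball, with the gradient still taken at rho. *)
have linear_bound omega : trace_ball eps sigma omega ->
    \tr (G *m (omega - sigma)) <= bound%:C.
  move=> [so oe]; have [ho to] := statesB so sigma_state.
  by have [] := optimality_gap_eq0 n0 hG ho to oe.
have [hD trD] := statesB rho_state sigma_state.
have [_ cond1E] := optimality_gap_eq0 n0 hG hD trD rho_eps.
have [pP pN _ _] := jordan_partsP hD.
have [pM [v [vG v1]]] := max_eigenvalueP n0 hG.
have [pm [w [wG w1]]] := min_eigenvalueP n0 hG.
have cond13 : cond1 <-> cond3.
  have scalarE := eq_extreme_eigenvalues n0 hG.
  have posE := iff_trans (psd_mxtrace_support pM pP) (compression_eq _ _ _).
  have negE := iff_trans (psd_mxtrace_support pm pN) (compression_eqN _ _ _).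
  split=> [/cond1E[e /posE p /negE q]|[e [/posE p /negE q]]].
    split; last exact: (conj p q).
    by case: e => [|/scalarE]; [left|right].
  apply/cond1E; split; [|exact: p|exact: q].
  by case: e => [|/scalarE]; [left|right].
have cond12 : cond1 <-> cond2.
  split=> [c1|[_ rho_max]].
    split=> [|omega omega_ball]; first by case: rho_ball.
    have [so _] := omega_ball; have [ho _] := statesB so rho_state.
    (* Equality at rho makes the slope towards omega the slack of [linear_bound] at omega, which is
       nonpositive. *)
    have trG : \tr (G *m (omega - rho)) = \tr (G *m (omega - sigma)) - bound%:C.
      by rewrite -c1 -linearB/= -mulmxBr opprB addrA subrK.
    have le_dir := concave_dir_derivative_ge f_concave rho_state so (f_cvg _ ho).
    rewrite -subr_le0; apply: le_trans le_dir _.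
    by rewrite -lecR -(dirG _ ho) trG subr_le0; exact: linear_bound.
  apply/le_anti; rewrite (linear_bound rho (proj1 rho_ball)) /=.
  have unit_trace (u : 'rV[R[i]]_n) : u *m u^t* = 1%:M -> \tr (u^t* *m u) = 1.
    by move=> u1; rewrite mxtrace_mulC u1 mxtrace1.
  (* Since [v] and [w] are row vectors, [v^t* *m v] and [w^t* *m w] are the rank-one projections
     onto extreme eigenvectors of G. *)
  have [r r0 segment] := trace_ball_segment eps_gt0 sigma_state rho_ball
    (psd_gram v) (psd_gram w) (unit_trace _ v1) (unit_trace _ w1).
  set h := sigma + _ - rho in segment.
  have hh : selfadjoint h.
    have -> : h = eps%:C *: (v^t* *m v - w^t* *m w) + (-1)%:C *: (rho - sigma).
      by rewrite /h rmorphN rmorph1 scaleN1r opprB addrCA addrA.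
    apply: selfadjoint_lin hD.
    exact: selfadjointB (psd_selfadjoint (psd_gram v)) (psd_selfadjoint (psd_gram w)).
  have dir_le0 : dir_derivative f rho h <= 0.
    apply: (dir_derivative_le0 r0) (f_cvg _ hh) => t tr.
    exact: rho_max (segment t tr).
  have eigen_trace (u : 'rV[R[i]]_n) x :
      u *m G = x *: u -> u *m u^t* = 1%:M -> \tr (G *m (u^t* *m u)) = x.
    move=> uG u1; rewrite mulmxA mxtrace_mulC mulmxA uG -scalemxAl u1.
    by rewrite linearZ/= mxtrace1 mulr1.
  (* The slope along h is exactly the gap, so its nonpositivity is the missing reverse
     inequality. *)
  have trGh : \tr (G *m h) = bound%:C - \tr (G *m (rho - sigma)).
    have -> : h = eps%:C *: (v^t* *m v - w^t* *m w) - (rho - sigma).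
      by rewrite /h opprB addrCA addrA.
    rewrite mulmxBr -scalemxAr mulmxBr linearB/= linearZ/= linearB/=.
    rewrite (eigen_trace v _ vG v1) (eigen_trace w _ wG w1).
    by rewrite /bound (rmorphM (real_complex R)) (rmorphB (real_complex R)).
  by rewrite -subr_le0 -trGh (dirG _ hh) lecR.
split; first exact: linear_bound (proj1 rho_ball).
by split=> //; exact: iff_trans (iff_sym cond12) cond13.
Qed.
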